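(* Let $p$ be an odd prime and let $G$ be a metabelian $p$-group. If $G$ is a generalized $T_2$-group, then $G$ is nilpotent of class (exactly) $3$.
   Context: A subgroup $H$ of a group $G$ is $2$-subnormal in $G$, written $H\lhd_2 G$, if there is a subgroup $H_1$ with $H\lhd H_1\lhd G$ (repetitions $H=H_1$ or $H_1=G$ are allowed). For a group $G$, $T_2(G)$ denotes the subgroup generated by all $x\in G$ such that $\langle x\rangle$ is not $2$-subnormal in $G$, with $T_2(G)=1$ if there are no such $x$. $G$ is a generalized $T_2$-group if $1\neq T_2(G)\neq G$. Groups are not assumed finite; a $p$-group is a group in which every element has order a power of $p$. *)

(* Defs.v *)
From mathcomp Require Import all_boot.
From mathcomp Require Import boolp classical_sets.

Set Implicit Arguments.
Unset Strict Implicit.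
Unset Printing Implicit Defensive.

Local Open Scope classical_set_scope.
Local Open Scope group_scope.

(* Subgroups of a possibly infinite group [G : groupType] are represented as
   subsets [H : set G]. *)
Definition subgroup (G : groupType) (H : set G) : Prop :=
  [/\ H 1,
      forall x y, H x -> H y -> H (x * y) &
      forall x, H x -> H x^-1].

Definition generated (G : groupType) (A : set G) : set G :=
  smallest (@subgroup G) A.

Definition normal_in (G : groupType) (H K : set G) : Prop :=
  [/\ subgroup H, subgroup K, H `<=` K &
      forall x y, H x -> K y -> H (x ^ y)].

Definition subnormal2 (G : groupType) (H : set G) : Prop :=
  exists H1 : set G, normal_in H H1 /\ normal_in H1 [set: G].

(* When every cyclic subgroup is 2-subnormal this is [generated set0], that is,
   the trivial subgroup. *)
Definition T2 (G : groupType) : set G :=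
  generated [set x | ~ subnormal2 (generated [set x])].
Arguments T2 : clear implicits.

Definition generalized_T2_group (G : groupType) : Prop :=
  T2 G <> [set 1] /\ T2 G <> [set: G].

Definition commutator_subgroup (G : groupType) (A B : set G) : set G :=
  generated [set [~ a, b] | a in A & b in B].

Definition derived_subgroup (G : groupType) (A : set G) : set G :=
  commutator_subgroup A A.

Definition metabelian (G : groupType) : Prop :=
  derived_subgroup (derived_subgroup [set: G]) = [set 1].

Definition has_order (G : groupType) (x : G) (n : nat) : Prop :=
  [/\ 0 < n, x ^+ n = 1 & forall m, 0 < m < n -> x ^+ m <> 1].

Definition p_group (p : nat) (G : groupType) : Prop :=
  forall x : G, exists k : nat, has_order x (p ^ k)%N.

(* Indexed from 0: [lower_central G n] is the term usually written
   gamma_(n+1)(G), so nilpotency class c means that [lower_central G c] is the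
   first trivial term. *)
Fixpoint lower_central (G : groupType) (n : nat) : set G :=
  if n is n'.+1 then commutator_subgroup (@lower_central G n') [set: G]
  else [set: G].
Arguments lower_central : clear implicits.

Definition nilpotent_of_class (G : groupType) (c : nat) : Prop :=
  lower_central G c = [set 1] /\
  forall m, m < c -> lower_central G m <> [set 1].

(* Main.v *)
Require Import Defs.
From mathcomp Require Import all_boot.
From mathcomp Require Import boolp classical_sets.

Local Open Scope classical_set_scope.
Local Open Scope group_scope.

(** Write [T] for [T2 G] and [D] for the abelian derived subgroup. Each [x]
    gives the endomorphism [X : a |-> [a, x]] of [D]; these endomorphisms
    commute, and [x * y] gives [X + Y + XY]. The theorem says that [X Y = 0] on
    [D] for all [x] and [y] (class at most 3), but that [D] is not central.

    Suppose [x] is outside [T]. Then [<x>] is 2-subnormal, so [[g, x, x]] is in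
    [<x>] for every [g] ([subnormal2_commg]), whence [[g, x, x, x] = 1].

    - Take also [y] and [x * y] outside [T]. On [a = [y, x]] the squares [X^2],
      [Y^2] and [(X + Y + XY)^2] vanish, so [2 a X Y = 0], and [a X Y = 0]
      because orders are odd ([commg_cross_sqr]). Every [y] can be reduced to
      this case by multiplying it by a power of [x] ([outside_subgroup_ind]),
      so that [[y, x, x, y] = 1] for every [y] ([commg_xxy]).
    - Linearise this in [y = g * h]. As [[g, x, x]] and [[h, x, x]] lie in a
      cyclic p-group, one is a power of the other, and this makes the mixed
      term vanish: [[h, x, x, g] = 1] for all [g], [h] ([commg_xxg]).
    - So [g |-> [g, x, x]] is a morphism to the centre, which kills [D]: that
      is, [X^2 = 0] on [D] ([derived_commgXX]).
    - The two devices of the first step, now on the whole of [D], turn the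
      vanishing of squares into [X Y = 0] for every [y], still with [x] outside
      [T] ([derived_commg_xy]). As [T] is a proper subgroup, any [x] in it
      is a quotient of two elements outside it, and [X Y = 0] always
      ([derived_commgg]).

    If the class were at most 2, the centraliser of any [x] would contain [D]
    and so be normal, and [<x>] is normal in it; all cyclic subgroups would be
    2-subnormal and [T] trivial ([class2_T2]). *)

(** * Generated subgroups *)

Lemma subgroup_generated {G : groupType} (A : set G) : subgroup (generated A).
Proof.
split=> [B [[]]//|x y Ax Ay B BP|x Ax B BP]; case: (BP) => -[_ BM BV] _.
- by apply: BM; [apply: Ax|apply: Ay].
- by apply: BV; apply: Ax.
Qed.

Lemma generated_sub {G : groupType} {A H : set G} :
  subgroup H -> A `<=` H -> generated A `<=` H.
Proof. exact: smallest_sub. Qed.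

Lemma sub_generated {G : groupType} (A : set G) : A `<=` generated A.
Proof. exact: sub_gen_smallest. Qed.

Lemma subgroup1 (G : groupType) : subgroup [set 1 : G].
Proof. by split=> [//|x y -> ->|x ->] /=; rewrite ?mulg1 ?invg1. Qed.

Lemma generated_eq1 {G : groupType} {A : set G} :
  A `<=` [set 1] -> generated A = [set 1].
Proof.
move=> A1; apply/seteqP; split; first exact: generated_sub (subgroup1 G) A1.
by move=> _ ->; case: (subgroup_generated A).
Qed.

Lemma subgroup_centraliser {G : groupType} (A : set G) :
  subgroup [set h | forall x, A x -> commute x h].
Proof.
split=> [x _|g h gP hP x Ax|h hP x Ax]; first exact: commute1.
- by apply: commuteM; [apply: gP|apply: hP].
- by apply: commuteV; apply: hP.
Qed.

Lemma subgroupX {G : groupType} {H : set G} {x : G} n :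
  subgroup H -> H x -> H (x ^+ n).
Proof.
move=> [H1 HM _] Hx; elim: n => [//|n IHn].
by rewrite expgS; apply: HM.
Qed.

(** * Elements of finite p-power order *)

Lemma cyclic_expP {G : groupType} {x y : G} {n} :
  (0 < n)%N -> x ^+ n = 1 -> generated [set x] y -> exists i, y = x ^+ i.
Proof.
move=> n0 xn1; apply: (@generated_sub _ _ [set y | exists i, y = x ^+ i]).
  split=> [|_ _ [i ->] [j ->]|_ [i ->]].
  - by exists 0.
  - by exists (i + j)%N; rewrite expgnDr.
  - exists (i * n.-1)%N; apply: mulg1_eq.
    by rewrite -expgnDr -mulnS prednK// mulnC expgnA xn1 expg1n.
by move=> _ ->; exists 1%N.
Qed.

(** The subgroups of a finite cyclic p-group form a chain: by Bezout the
    subgroup generated by [x ^+ l] is that of [x ^+ gcdn l (p ^ k)], and the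
    powers of [p] are totally ordered by divisibility. *)
Lemma cyclic_p_comparable {G : groupType} {x u v : G} {p k} :
    prime p -> x ^+ (p ^ k)%N = 1 ->
    generated [set x] u -> generated [set x] v ->
  (exists j, u = v ^+ j) \/ (exists j, v = u ^+ j).
Proof.
move=> pp xq1; have q0 : (0 < p ^ k)%N by rewrite expn_gt0 prime_gt0.
have gcd_exp l : exists2 s, (p ^ s %| l)%N &
    exists m, x ^+ (p ^ s)%N = x ^+ l ^+ m.
  have /(dvdn_pfactor _ _ pp)[s _ gs] := dvdn_gcdr l (p ^ k).
  exists s; first by rewrite -gs dvdn_gcdl.
  have [l0|l0] := posnP l; first by exists 0; rewrite -gs l0 gcd0n.
  have [a b abE _] := egcdnP (p ^ k) l0; exists a.
  by rewrite -gs -expgnA mulnC abE expgnDr mulnC expgnA xq1 expg1n mul1g.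
move=> /(cyclic_expP q0 xq1)[i ->] /(cyclic_expP q0 xq1)[j ->].
have [s si [a xs]] := gcd_exp i; have [t tj [b xt]] := gcd_exp j.
have [st|/ltnW ts] := leqP s t; [right|left].
  have /dvdnP[c ->] := dvdn_trans (dvdn_exp2l p st) tj.
  by exists (a * c)%N; rewrite mulnC expgnA xs -expgnA.
have /dvdnP[c ->] := dvdn_trans (dvdn_exp2l p ts) si.
by exists (b * c)%N; rewrite mulnC expgnA xt -expgnA.
Qed.

Section OddPGroup.
Context {p : nat} {G : groupType} (hp : prime p) (hodd : odd p).
Context (hpG : p_group p G).

Lemma p_group_expg1 (x : G) : exists k, x ^+ (p ^ k)%N = 1.
Proof. by have [k [_ xk _]] := hpG x; exists k. Qed.

Lemma p_group_sqrg_root (x : G) : exists m, x = (x ^+ 2) ^+ m.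
Proof.
have [k xk] := p_group_expg1 x; exists (p ^ k)./2.+1.
rewrite -expgnA mul2n -{1}[x]mul1g -xk -expgSr; congr (x ^+ _).
by rewrite doubleS -[in LHS](odd_double_half (p ^ k)) oddX hodd orbT.
Qed.

Lemma p_group_sqrg_eq1 {x : G} : x ^+ 2 = 1 -> x = 1.
Proof. by move=> x2; have [m ->] := p_group_sqrg_root x; rewrite x2 expg1n. Qed.

End OddPGroup.

(** * Commutators in a metabelian group *)

Section Commutators.
Context {G : groupType}.
Implicit Types x y z : G.

Lemma commMgJ x y z : [~ x * y, z] = [~ x, z] ^ y * [~ y, z].
Proof. by rewrite /commg /conjg !gnorm. Qed.

Lemma commgMJ x y z : [~ x, y * z] = [~ x, z] * [~ x, y] ^ z.
Proof. by rewrite /commg /conjg !gnorm. Qed.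

Lemma commg_eq1P {x y} : [~ x, y] = 1 <-> commute x y.
Proof. by split=> [/eqP/commgP|/commgP/eqP]. Qed.

Lemma conjg_mulR x y : x ^ y = x * [~ x, y].
Proof. by rewrite /commg mulVKg. Qed.

Lemma conjg_id {x y} : commute x y -> x ^ y = x.
Proof. by move=> /commg_eq1P xy; rewrite conjg_mulR xy mulg1. Qed.

Lemma commXg1 {x y} n : [~ x, y] = 1 -> [~ x ^+ n, y] = 1.
Proof.
by move=> /commg_eq1P/commute_sym xy; apply/commg_eq1P/commute_sym/commuteX.
Qed.

End Commutators.

Section Metabelian.
Context {G : groupType} (hmet : metabelian G).
Local Notation D := (derived_subgroup [set: G]).
Implicit Types a b c x y g h : G.

Lemma mem_derived x y : D [~ x, y].
Proof. by apply: sub_generated; exists x => //; exists y. Qed.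

Lemma derived_commute {a b} : D a -> D b -> commute a b.
Proof.
move=> Da Db; apply/commg_eq1P; have : derived_subgroup D [~ a, b].
  by apply: sub_generated; exists a => //; exists b.
by rewrite hmet.
Qed.

Lemma commMg_derived {a b} g : D b -> [~ a * b, g] = [~ a, g] * [~ b, g].
Proof.
by move=> Db; rewrite commMgJ (conjg_id (derived_commute (mem_derived _ _) Db)).
Qed.

Lemma commVg_derived a g : D a -> [~ a^-1, g] = [~ a, g]^-1.
Proof.
have [_ _ DV] :=
  subgroup_generated [set [~ x, y] | x in [set: G] & y in [set: G]].
move=> Da; symmetry; apply: mulg1_eq.
by rewrite -commMg_derived ?mulgV ?comm1g//; apply: DV.
Qed.

(** The factors of [commgMJ] commute, so that this is [(1 + X)(1 + Y) - 1 =
    X + Y + XY] in operator form. *)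
Lemma commgM_derived a g h :
  [~ a, g * h] = [~ a, g] * [~ a, h] * [~ a, g, h].
Proof.
rewrite commgMJ conjg_mulR mulgA; congr (_ * _).
exact: derived_commute (mem_derived _ _) (mem_derived _ _).
Qed.

(** [[a, g * h]] and [[a, h * g]] agree because [[g, h]] acts trivially on
    [D]; expanding both leaves the two sides. *)
Lemma commgAC {a} g h : D a -> [~ a, g, h] = [~ a, h, g].
Proof.
move=> Da; have agh : [~ a, g * h] = [~ a, h * g].
  rewrite [g * h]commgC commgM_derived; set c := [~ g, h].
  have ac b : D b -> [~ b, c] = 1.
    by move=> Db; apply/commg_eq1P/derived_commute => //; apply: mem_derived.
  by rewrite ac// ac ?mulg1//; apply: mem_derived.
move: agh; rewrite !commgM_derived.
rewrite (derived_commute (mem_derived a g) (mem_derived a h)).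
exact: mulgI.
Qed.

(** In operator form, [a X^2 = a Y^2 = a (X + Y + XY)^2 = 0] leaves only the
    cross term [2 a X Y = 0] of the last square. *)
Lemma commg_cross_sqr {a x y} : D a -> [~ a, x, x] = 1 -> [~ a, y, y] = 1 ->
  [~ a, x * y, x * y] = 1 -> [~ a, x, y] ^+ 2 = 1.
Proof.
move=> Da axx ayy; have Dc := mem_derived.
have ayx : [~ a, y, x] = [~ a, x, y] by rewrite commgAC.
have axyx : [~ a, x, y, x] = 1 by rewrite commgAC// axx comm1g.
have axyy : [~ a, x, y, y] = 1 by rewrite -ayx commgAC// ayy comm1g.
rewrite [[~ a, x * y]]commgM_derived commMg_derived// commMg_derived//.
rewrite 3!commgM_derived.
by rewrite axx ayy ayx axyx axyy !comm1g !mulg1 mul1g.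
Qed.

(** Operator form: [X (X + Y + XY) = X Y] wherever [X^2 = 0]. Together with
    [outside_subgroup_ind] this allows [y] to be multiplied by powers of [x]. *)
Lemma commg_shift {a x} y : [~ a, x, x] = 1 -> [~ a, x, x * y] = [~ a, x, y].
Proof. by move=> axx; rewrite commgM_derived axx comm1g mulg1 mul1g. Qed.

(** As [[g * h, x] = [g, x] * [g, x, h] * [h, x]] and [[g, x, h, x] = 1], the
    map [g |-> [g, x, x]] is a morphism to an abelian group, hence trivial on
    the derived subgroup. *)
Lemma derived_commgXX {x} : (forall g h, [~ g, x, x, h] = 1) ->
  forall a, D a -> [~ a, x, x] = 1.
Proof.
move=> xxC; have Dc := mem_derived.
have fM g h : [~ g * h, x, x] = [~ g, x, x] * [~ h, x, x].
  rewrite [[~ g * h, x]]commMgJ conjg_mulR commMg_derived// commMg_derived//.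
  by rewrite [[~ g, x, h, x]]commgAC// xxC mulg1.
apply: generated_sub => [|_ [g _ [h _ <-]]] /=.
  split=> [|g h gx hx|g gx] /=; first by rewrite !comm1g.
  - by rewrite fM gx hx mulg1.
  - by have := fM g g^-1; rewrite mulgV !comm1g gx mul1g.
have := fM g h; rewrite [g * h]commgC 2!fM; set u := _ * _.
rewrite (derived_commute (mem_derived [~ g, x] x) (mem_derived [~ h, x] x)).
by rewrite -[RHS]mulg1 => /mulgI.
Qed.

Lemma class3_commg : (forall a x y, D a -> [~ a, x, y] = 1) ->
  lower_central G 3 = [set 1].
Proof.
move=> Dxy; apply: generated_eq1 => _ [b Db [g _ <-]]; apply/commg_eq1P.
apply/commute_sym; move: b Db g.
suff: lower_central G 2 `<=` [set b | forall g, [set: G] g -> commute g b].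
  by move=> sub b /sub bC g; apply: bC.
apply: generated_sub; first exact: subgroup_centraliser.
by move=> _ [a Da [y _ <-]] g _ /=; apply/commute_sym/commg_eq1P/Dxy.
Qed.

End Metabelian.

(** * Cyclic 2-subnormal subgroups *)

Section CyclicSubnormal.
Context {G : groupType}.
Implicit Types x g : G.

Lemma cyclic_commute {x y} : generated [set x] y -> commute x y.
Proof.
suff: generated [set x] `<=` [set y | forall z, [set x] z -> commute z y].
  by move=> sub /sub; apply.
by apply: generated_sub; [apply: subgroup_centraliser|move=> _ -> z ->].
Qed.

(** If [<x>] is normal in [H1] and [H1] in [G], then [[g, x] = (x^-1) ^ g * x]
    lies in [H1], which normalises [<x>]. *)
Lemma subnormal2_commg {x} : subnormal2 (generated [set x]) ->
  forall g, generated [set x] [~ g, x, x].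
Proof.
have xx : generated [set x] x by apply: sub_generated.
have [_ M V] := subgroup_generated [set x].
move=> [H1 [[_ [_ H1M H1V] xH1 nx] [_ _ _ nH1]]] g.
have H1gx : H1 [~ g, x].
  by rewrite commgEr; apply: H1M; [apply: nH1 => //|]; auto.
by rewrite commgEr; apply: M => //; apply: nx => //; apply: V.
Qed.

Lemma subnormal2_Engel {x} : subnormal2 (generated [set x]) ->
  forall g, [~ g, x, x, x] = 1.
Proof.
move=> sx g; apply/commg_eq1P/commute_sym/cyclic_commute.
exact: subnormal2_commg.
Qed.

(** When the derived subgroup is central, the centraliser of [x] contains it
    and is therefore normal in [G], while [<x>] is central in that
    centraliser. *)
Lemma class2_subnormal2 x : lower_central G 2 = [set 1] ->
  subnormal2 (generated [set x]).
Proof.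
move=> G2; pose C := [set h | forall z, [set x] z -> commute z h].
have sC : subgroup C by apply: subgroup_centraliser.
have xC : generated [set x] `<=` C.
  by apply: generated_sub => // _ -> z ->.
have G'C a b g : [~ a, b, g] = 1.
  suff: lower_central G 2 [~ a, b, g] by rewrite G2.
  apply: sub_generated; exists [~ a, b]; last by exists g.
  by apply: sub_generated; exists a => //; exists b.
exists C; split; split => //.
- exact: subgroup_generated.
- move=> y h xy Ch; suff -> : y ^ h = y by [].
  apply: conjg_id; move: y xy.
  suff: generated [set x] `<=` [set y | forall z, [set h] z -> commute z y].
    by move=> sub y /sub /(_ h erefl)/commute_sym.
  apply: generated_sub; first exact: subgroup_centraliser.
  by move=> _ -> _ ->; apply/commute_sym/Ch.
- move=> h g Ch _; rewrite conjg_mulR; case: sC => _ CM _; apply: CM => //.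
  by move=> _ ->; apply/commute_sym/commg_eq1P.
Qed.

Lemma class2_T2 : lower_central G 2 = [set 1] -> T2 G = [set 1].
Proof.
move=> G2; apply: generated_eq1 => x /= nx.
by case: nx; apply: class2_subnormal2.
Qed.

Lemma notin_T2_subnormal2 {x} : ~ T2 G x -> subnormal2 (generated [set x]).
Proof. by move=> xT; apply: contrapT => nx; apply: xT => T [_]; apply. Qed.

End CyclicSubnormal.

(** * The upper bound on the class *)

(** Among [y], [x * y], [x ^+ 2 * y], [x ^+ 3 * y] there are two consecutive
    elements outside [T]; from there [P] descends to [y]. *)
Lemma outside_subgroup_ind {G : groupType} {T : set G} {x : G} (P : G -> Prop) :
    subgroup T -> ~ T x -> ~ T (x ^+ 2) ->
    (forall y, P (x * y) -> P y) ->
    (forall y, ~ T y -> ~ T (x * y) -> P y) ->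
  forall y, P y.
Proof.
move=> [_ TM TV] xT x2T Pshift Pout.
have TMr z y : ~ T z -> T y -> ~ T (z * y).
  move=> zT yT zyT; apply: zT; rewrite -[z](mulgK y).
  by apply: TM => //; apply: TV.
have PT y : T y -> P y.
  move=> yT; apply/Pshift/Pout; first exact: TMr.
  by rewrite mulgA; apply: TMr.
move=> y; have [/PT//|yT] := pselect (T y).
have [/PT/Pshift//|xyT] := pselect (T (x * y)).
exact: Pout.
Qed.

Section UpperBound.
Context {p : nat} {G : groupType} (hp : prime p) (hodd : odd p).
Context (hmet : metabelian G) (hpG : p_group p G).
Local Notation D := (derived_subgroup [set: G]).
Implicit Types a g h x y t : G.

Lemma notin_T2_sqr {x} : ~ T2 G x -> ~ T2 G (x ^+ 2).
Proof.
move=> xT x2T; apply: xT; have [m ->] := p_group_sqrg_root hodd hpG x.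
exact: subgroupX (subgroup_generated _) x2T.
Qed.

Lemma T2_outside_ind {x} (P : G -> Prop) : ~ T2 G x ->
    (forall y, P (x * y) -> P y) ->
    (forall y, ~ T2 G y -> ~ T2 G (x * y) -> P y) ->
  forall y, P y.
Proof.
move=> xT.
exact: outside_subgroup_ind (subgroup_generated _) xT (notin_T2_sqr xT).
Qed.

(** The Engel identities of [x], [y] and [x * y], all read on [[y, x]], are the
    three vanishing squares of [commg_cross_sqr]. *)
Lemma commg_xxy {x} : ~ T2 G x -> forall y, [~ y, x, x, y] = 1.
Proof.
move=> xT; have Ex := subnormal2_Engel (notin_T2_subnormal2 xT).
apply: (T2_outside_ind _ xT) => y.
  rewrite [[~ x * y, x]]commMgJ commgg conj1g mul1g.
  by rewrite (commg_shift hmet)//; apply: Ex.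
move=> yT xyT; apply: (p_group_sqrg_eq1 hodd hpG).
have Dc := @mem_derived G.
apply: (commg_cross_sqr hmet) => //.
(* Inverting turns [[x, y]] into [[y, x]], and [[x, x * y]] into
   [[x * y, x] = [y, x]]. *)
- have /(congr1 inv) := subnormal2_Engel (notin_T2_subnormal2 yT) x.
  by rewrite invg1 -commVg_derived// -commVg_derived// invgR.
- have := subnormal2_Engel (notin_T2_subnormal2 xyT) x.
  move/(congr1 inv); rewrite invg1 -commVg_derived// -commVg_derived// invgR.
  by rewrite [[~ x * y, x]]commMgJ commgg conj1g mul1g.
Qed.

(** With [u = [g, x, x]] and [v = [h, x, x]], expanding
    [[g * h, x, x, g * h] = 1] leaves [[v, g] * [u, h] = 1] up to images of
    [[u, h]]. If [v] is a power of [u], then [[v, g] = 1] since [[u, g] = 1]; if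
    [u] is a power of [v], then [[u, h] = 1] since [[v, h] = 1], and the
    expansion reduces to [[v, g] = 1]. *)
Lemma commg_xxg {x} : ~ T2 G x -> forall h g, [~ h, x, x, g] = 1.
Proof.
move=> xT h g; have sx := notin_T2_subnormal2 xT.
have Dc := @mem_derived G.
set v := [~ h, x, x]; pose u := [~ g, x, x].
have ug : [~ u, g] = 1 by apply: commg_xxy.
have vh : [~ v, h] = 1 by apply: commg_xxy.
have [k xk] := p_group_expg1 hpG x.
have [] := cyclic_p_comparable hp xk
  (subnormal2_commg sx g) (subnormal2_commg sx h).
- move=> [j uE]; have uh : [~ u, h] = 1 by rewrite [u]uE commXg1.
  have gh : [~ g * h, x, x] = u * v.
    rewrite [[~ g * h, x]]commMgJ conjg_mulR commMg_derived// commMg_derived//.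
    by rewrite [[~ g, x, h, x]]commgAC// -/u uh mulg1.
  have := commg_xxy xT (g * h); rewrite gh commMg_derived//; last exact: Dc.
  rewrite 2!(commgM_derived hmet) ug uh vh comm1g !mulg1 mul1g.
  by rewrite commgAC ?vh ?comm1g ?mulg1//; apply: Dc.
- by move=> [j vE]; rewrite [v]vE commXg1.
Qed.

Lemma derived_commg_xx {a x} : D a -> ~ T2 G x -> [~ a, x, x] = 1.
Proof. by move=> Da xT; apply: (derived_commgXX hmet (commg_xxg xT)). Qed.

Lemma derived_commg_xy {a x} : D a -> ~ T2 G x -> forall y, [~ a, x, y] = 1.
Proof.
move=> Da xT; apply: (T2_outside_ind _ xT) => y.
  by rewrite (commg_shift hmet)//; apply: derived_commg_xx.
move=> yT xyT; apply: (p_group_sqrg_eq1 hodd hpG).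
by apply: (commg_cross_sqr hmet) => //; apply: derived_commg_xx.
Qed.

Lemma derived_commgg {t} : ~ T2 G t -> forall a x y, D a -> [~ a, x, y] = 1.
Proof.
move=> tT a x y Da.
have [xT|xT] := pselect (T2 G x); last exact: derived_commg_xy.
have [_ TM TV] :=
  subgroup_generated [set x : G | ~ subnormal2 (generated [set x])].
have txT : ~ T2 G (t * x).
  by move=> txT; apply: tT; rewrite -[t](mulgK x); apply: TM => //; apply: TV.
have Dc := @mem_derived G.
have := derived_commg_xy Da txT y; rewrite commgM_derived//.
rewrite (derived_commg_xy Da tT x) mulg1 commMg_derived//.
by rewrite derived_commg_xy// mul1g.
Qed.

End UpperBound.

Theorem theorem3p1 (p : nat) (G : groupType) (hp : prime p) (hodd : odd p)
  (hmet : metabelian G) (hpG : p_group p G) (hT2 : generalized_T2_group G) :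
  nilpotent_of_class G 3.
Proof.
case: hT2 => T2neq1 T2neqG; split.
  have [t tT] : exists t, ~ T2 G t.
    by apply/existsNP => allT; apply: T2neqG; apply/seteqP; split.
  exact/class3_commg/(derived_commgg hp hodd hmet hpG tT).
have step n : lower_central G n = [set 1] -> lower_central G n.+1 = [set 1].
  move=> n1; apply: generated_eq1; rewrite -/(lower_central G n) n1.
  by move=> _ [_ -> [b _ <-]]; apply: comm1g.
case=> [|[|[|//]]] _ Gm1; apply/T2neq1/class2_T2 => //.
- exact/step/step.
- exact: step.
Qed.
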